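(* Let $m>1$ be an integer and let $K\subset S_m$ be a (nonempty) compact set of lotteries over $\{1,\ldots,m\}$ such that $$\eta := \max_{(\pi_1,\ldots,\pi_m)\in K}\ \max_{i\in\{1,\ldots,m\}} \pi_i<1 \qquad\text{and}\qquad \nu := \min_{i\in\{1,\ldots,m\}}\ \max_{(\pi_1,\ldots,\pi_m)\in K}\pi_i>0 .$$ For every integer $n\ge 1$ consider Bachet's game with lottery moves with parameters $n$, $m$, $K$. Then for every $n\ge 1$ this game has a non-empty set of subgame perfect Nash equilibria; the probability $p_n$ that the first player wins when an arbitrary subgame perfect Nash equilibrium is played does not depend on the choice of the equilibrium; and $$\lim_{n\to\infty}p_n=\frac12 .$$
   Context: $S_m=\{(\pi_1,\ldots,\pi_m)\in\mathbb R^m:\ \pi_i\ge 0,\ \sum_{i=1}^m\pi_i=1\}$ is the simplex of all lotteries (probability distributions) over $\{1,2,\ldots,m\}$. Bachet's game with lottery moves with parameters $n$ (a natural number), $m$ (a natural number) and $K\subset S_m$: there is a pile of $n$ objects. Two players move alternately. At each move the player whose turn it is chooses a lottery $(\pi_1,\ldots,\pi_m)\in K$; then the lottery is realized (independently of everything else), giving a number $i\in\{1,\ldots,m\}$ with probability $\pi_i$, the realization is observed, and the player takes $i$ objects from the pile. The player who takes the last object loses, including the case when they have to take more objects than remain in the pile (that is, a player whose realized number $i$ is at least the current size of the pile loses and the game ends); the other player wins. Both players want to maximize the probability of their own victory. This is an extensive-form game of perfect information with chance moves; a strategy of a player assigns to each history after which that player is to move an element of $K$. A subgame perfect Nash equilibrium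 is a pair of strategies which induces a Nash equilibrium in every subgame. *)

(* Defs.v *)
From HB Require Import structures.
From mathcomp Require Import all_boot all_order all_algebra.
From mathcomp Require Import all_classical all_reals all_analysis.

Set Implicit Arguments.
Unset Strict Implicit.
Unset Printing Implicit Defensive.

Import Order.TTheory GRing.Theory Num.Theory.
Import numFieldNormedType.Exports.

Local Open Scope classical_set_scope.
Local Open Scope ring_scope.

(* The index i : 'I_m stands for the realization i.+1, i.e. for taking i.+1
   objects; thus pi 0 i is the probability of taking i.+1 objects. *)
Definition simplex (R : realType) (m : nat) : set 'rV[R]_m :=
  [set pi | (forall i, 0 <= pi 0 i) /\ \sum_(i < m) pi 0 i = 1].
Arguments simplex : clear implicits.

(* The default values 0 and 1 of the finite max and min are harmless, since the
   coordinates of a lottery lie in [0, 1]; on a nonempty compact set the suprema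
   below are attained. *)
Definition eta_of (R : realType) (m : nat) (K : set 'rV[R]_m) : R :=
  sup [set \big[Num.max/0]_(i < m) pi 0 i | pi in K].

Definition nu_of (R : realType) (m : nat) (K : set 'rV[R]_m) : R :=
  \big[Num.min/1]_(i < m) sup [set pi 0 i | pi in K].

(* Past moves (chosen lottery, realization), the most recent one first. *)
Definition history (R : realType) (m : nat) : Type := seq ('rV[R]_m * 'I_m).

Definition taken (R : realType) (m : nat) (h : history R m) : nat :=
  \sum_(x <- h) x.2.+1.

(* Objects left after h when n objects were there initially; by truncation this
   is 0 also when the last player had to take more objects than remained. *)
Definition pile (R : realType) (m n : nat) (h : history R m) : nat :=
  n - taken h.

(* Players are booleans: false is the first player, true the second one. *)
Definition mover (R : realType) (m : nat) (h : history R m) : bool :=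
  odd (size h).

(* Only the values at decision histories of the player using the strategy
   matter; see is_strategy. *)
Definition strategy (R : realType) (m : nat) : Type :=
  history R m -> 'rV[R]_m.

Definition profile (R : realType) (m : nat) : Type := bool -> strategy R m.

(* Since every realization is positive, a nonempty pile after h means that the
   game did not end earlier along h either. *)
Definition decision_history (R : realType) (m n : nat) (K : set 'rV[R]_m)
    (h : history R m) : Prop :=
  (forall x, x \in h -> K x.1) /\ (0 < pile n h)%N.

Definition is_strategy (R : realType) (m n : nat) (K : set 'rV[R]_m)
    (p : bool) (t : strategy R m) : Prop :=
  forall h, decision_history n K h -> mover h = p -> K (t h).

(* Probability that player p wins when s is played from the history h on, with k
   objects left. When the pile becomes empty, the player who moved last loses,
   so the winner is the player who would be next to move. Taking i.+1 objects
   out of k'.+1 leaves k' - i (truncated). *)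
Fixpoint win_prob (R : realType) (m : nat) (s : profile R m) (p : bool)
    (k : nat) (h : history R m) {struct k} : R :=
  if k is k'.+1 then
    let pi := s (mover h) h in
    \sum_(i < m) pi 0 i * win_prob s p (k' - i)%N ((pi, i) :: h)
  else (mover h == p)%:R.

(* Roots of subgames: a player is to move after h, or the lottery pi has been
   chosen after h and chance is to move. *)
Variant node (R : realType) (m : nat) : Type :=
  | Decision of history R m
  | Chance of history R m & 'rV[R]_m.

Definition game_node (R : realType) (m n : nat) (K : set 'rV[R]_m)
    (x : node R m) : Prop :=
  match x with
  | Decision h => decision_history n K h
  | Chance h pi => decision_history n K h /\ K pi
  end.

Definition node_win_prob (R : realType) (m n : nat) (s : profile R m)
    (p : bool) (x : node R m) : R :=
  match x with
  | Decision h => win_prob s p (pile n h) h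
  | Chance h pi => \sum_(i < m) pi 0 i *
      win_prob s p (pile n ((pi, i) :: h)) ((pi, i) :: h)
  end.

(* Deviations range over strategies of the whole game: only their restrictions
   to the subgame rooted at x affect node_win_prob. *)
Definition nash_at (R : realType) (m n : nat) (K : set 'rV[R]_m)
    (s : profile R m) (x : node R m) : Prop :=
  forall (p : bool) (t : strategy R m), is_strategy n K p t ->
    node_win_prob n [eta s with p |-> t] p x <= node_win_prob n s p x.

Definition subgame_perfect (R : realType) (m n : nat) (K : set 'rV[R]_m)
    (s : profile R m) : Prop :=
  (forall p, is_strategy n K p (s p)) /\
  (forall x, game_node n K x -> nash_at n K s x).

Definition first_win_prob (R : realType) (m n : nat) (s : profile R m) : R :=
  node_win_prob n s false (Decision [::]).

(* Main.v *)
Require Import Defs.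
From mathcomp Require Import all_boot all_order all_algebra.
From mathcomp Require Import all_classical all_reals all_analysis.
From mathcomp Require Import lra zify.

(** Backward induction solves the game: with [v 0 = 1] (the player facing an
    empty pile has won) and
      [v k.+1 = max_(pi in K) \sum_i pi_i (1 - v (k - i))],
    the maximum being attained because [K] is compact, the profile in which
    both players always choose a maximizing lottery is subgame perfect.
    Conversely, in any subgame perfect equilibrium the mover wins with
    probability [v] of the current pile ([subgame_perfect_value]): by induction
    on the pile the probabilities after the next move are known, and a single
    deviation to a maximizing lottery secures [v].

    For the limit, pass to the zero-sum quantity [q k = v k - 1/2], which
    satisfies [q k.+1 = max_(pi in K) - \sum_i pi_i q (k - i)]. If [|q| <= M]
    from some point on, then [|q| <= (1 - nu (1 - eta)) M] after a further delay
    that does not depend on [M] ([advantage_contract]), whence geometric decay.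
    The reason is that a position as bad as [- M] would force the [m] preceding
    ones to be as good as [M], since [nu > 0] lets the mover reach each of them
    with positive probability. But then the nearest of them would need a lottery
    leading only to positions near [- M], whereas all the positions that it
    leads to, except the farthest one, are among those near [M], and no lottery
    leads to the farthest one with probability above [eta < 1]
    ([advantage_lower]). Thus no late position is near [- M], and then none is
    near [M] either, because reaching [M] means moving to positions near
    [- M]. *)

Set Implicit Arguments.
Unset Strict Implicit.
Unset Printing Implicit Defensive.

Import Order.TTheory GRing.Theory Num.Theory.
Import numFieldNormedType.Exports.

Local Open Scope classical_set_scope.
Local Open Scope ring_scope.

(** * Bellman equation *)

Lemma linear_attains_max (R : realType) (m : nat) (K : set 'rV[R]_m)
    (c : 'I_m -> R) :
  K !=set0 -> compact K ->
  exists2 pi, K pi & forall rho, K rho ->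
    \sum_(i < m) rho 0 i * c i <= \sum_(i < m) pi 0 i * c i.
Proof.
move=> K0 Kc.
have cont : continuous (fun rho : 'rV[R]_m => \sum_(i < m) rho 0 i * c i).
  apply: continuous_big; first exact: add_continuous.
  move=> i _ rho; apply: continuousM; last exact: cst_continuous.
  exact: coord_continuous.
have [pi Kpi piP] := compact_EVT_max K0 Kc (continuous_subspaceT cont).
exists pi; first exact: set_mem.
by move=> rho Krho; apply: piP; exact: mem_set.
Qed.

Fixpoint value (R : realType) (m : nat) (K : set 'rV[R]_m) (k : nat) : R :=
  if k is k'.+1 then
    sup [set \sum_(i < m) pi 0 i * (1 - value K (k' - i)%N) | pi in K]
  else 1.

(** [v] solves the backward induction, and [opt k] is an optimal lottery with
    [k] objects left; [opt 0] is arbitrary since the game is then over. *)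
Definition bellman (R : realType) (m : nat) (K : set 'rV[R]_m)
    (v : nat -> R) (opt : nat -> 'rV[R]_m) : Prop :=
  v 0%N = 1 /\ forall k,
    [/\ K (opt k.+1),
        v k.+1 = \sum_(i < m) opt k.+1 0 i * (1 - v (k - i)%N)
      & forall pi, K pi ->
          \sum_(i < m) pi 0 i * (1 - v (k - i)%N) <= v k.+1].

Lemma bellman_value (R : realType) (m : nat) (K : set 'rV[R]_m) :
  K !=set0 -> compact K -> exists opt, bellman K (value K) opt.
Proof.
move=> K0 Kc.
have step k : exists2 pi, K pi & forall rho, K rho ->
    \sum_(i < m) rho 0 i * (1 - value K (k - i)%N) <=
    \sum_(i < m) pi 0 i * (1 - value K (k - i)%N).
  exact: (linear_attains_max (fun i : 'I_m => 1 - value K (k - i)%N) K0 Kc).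
exists (fun k => s2val (cid2 (step k.-1))); split=> // k /=.
case: (cid2 (step k)) => pi /= Kpi piP.
rewrite -/(value K k.+1).
suff -> : value K k.+1 = \sum_(i < m) pi 0 i * (1 - value K (k - i)%N) by [].
apply/eqP; rewrite eq_le; apply/andP; split=> /=.
  apply: ge_sup => [|_ [rho Krho <-]]; last exact: piP.
  by exists (\sum_(i < m) pi 0 i * (1 - value K (k - i)%N)), pi.
apply: ub_le_sup; last by exists pi.
exists (\sum_(i < m) pi 0 i * (1 - value K (k - i)%N)) => _ [rho Krho <-].
exact: piP.
Qed.

Lemma bellman_bounds (R : realType) (m : nat) (K : set 'rV[R]_m) v opt :
  K `<=` simplex R m -> bellman K v opt -> forall k, 0 <= v k <= 1.
Proof.
move=> KS [v0 vS]; elim/ltn_ind => -[_|k IH]; first by rewrite v0 ler01 lexx.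
have [/KS [pi0 pi1] -> _] := vS k; apply/andP; split.
  apply: sumr_ge0 => i _; rewrite mulr_ge0// subr_ge0.
  by have /andP[] := IH (k - i)%N (leq_subr _ _).
rewrite -[leRHS]pi1; apply: ler_sum => i _; rewrite ler_piMr// lerBlDr lerDl.
by have /andP[] := IH (k - i)%N (leq_subr _ _).
Qed.

(** * Play and its value *)

Lemma negb_eq (b : bool) : (~~ b == b) = false.
Proof. by case: b. Qed.

Lemma pile_cons (R : realType) (m n : nat) (h : history R m) pi (i : 'I_m) :
  pile n ((pi, i) :: h) = ((pile n h).-1 - i)%N.
Proof. by rewrite /pile /taken big_cons /=; lia. Qed.

Lemma mover_cons (R : realType) (m : nat) x (h : history R m) :
  mover (x :: h) = ~~ mover h.
Proof. by []. Qed.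

(** The probability with which [p] should win from [h]: [v] is the value for the
    player to move. *)
Definition play_value (R : realType) (m : nat) (v : nat -> R) (p : bool)
    (k : nat) (h : history R m) : R :=
  if mover h == p then v k else 1 - v k.

Lemma play_value_opponent (R : realType) (m : nat) (v : nat -> R) p k
    (h : history R m) :
  play_value v (~~ p) k h = 1 - play_value v p k h.
Proof.
by rewrite /play_value; case: (mover h); case: p => //=; rewrite opprB addrC subrK.
Qed.

Lemma expect_compl (R : realType) (m : nat) (pi : 'rV[R]_m) (f : 'I_m -> R) :
  simplex R m pi ->
  \sum_(i < m) pi 0 i * (1 - f i) = 1 - \sum_(i < m) pi 0 i * f i.
Proof.
move=> [_ pi1]; rewrite -[X in _ = X - _]pi1 -sumrB.
by apply: eq_bigr => i _; rewrite mulrBr mulr1.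
Qed.

Definition stays_in (R : realType) (m n : nat) (K : set 'rV[R]_m)
    (s : profile R m) := forall p, is_strategy n K p (s p).

Definition moves_in (R : realType) (m : nat) (K : set 'rV[R]_m)
    (h : history R m) := forall x, x \in h -> K x.1.

Lemma moves_in_cons (R : realType) (m : nat) (K : set 'rV[R]_m) pi (i : 'I_m)
    (h : history R m) :
  K pi -> moves_in K h -> moves_in K ((pi, i) :: h).
Proof.
by move=> Kpi Kh x; rewrite inE => /orP[/eqP->//|/Kh].
Qed.

(** Somebody wins in the end, so that bounding what each player can get also
    bounds it from below. This relies on the lotteries having total mass 1,
    hence on all the moves played belonging to [K]. *)
Lemma win_prob_opponent (R : realType) (m n : nat) (K : set 'rV[R]_m) s p h :
  K `<=` simplex R m -> stays_in n K s -> moves_in K h ->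
  win_prob s (~~ p) (pile n h) h = 1 - win_prob s p (pile n h) h.
Proof.
move=> KS sK; move E : (pile n h) => k; elim/ltn_ind: k h E => -[_|k IH] h E Kh.
  by rewrite /=; case: (mover h); case: p => /=; rewrite ?subr0 ?subrr.
have Ks : K (s (mover h) h) by apply: sK => //; split=> //; rewrite E.
rewrite /= -expect_compl; last exact: KS.
apply: eq_bigr => i _; rewrite IH ?ltnS ?leq_subr//.
  by rewrite pile_cons E.
exact: moves_in_cons.
Qed.

(** Against an opponent who maximizes, nobody does better than the value: the
    mover by optimality of [v], the other player because the value is attained
    by the opponent's choice. *)
Lemma optimal_reply_bound (R : realType) (m n : nat) (K : set 'rV[R]_m)
    v opt s p h :
  K `<=` simplex R m -> bellman K v opt -> stays_in n K s ->
  (forall h, s (~~ p) h = opt (pile n h)) -> moves_in K h ->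
  win_prob s p (pile n h) h <= play_value v p (pile n h) h.
Proof.
move=> KS [v0 vS] sK sopt.
move E : (pile n h) => k; elim/ltn_ind: k h E => -[_|k IH] h E Kh.
  by rewrite /= /play_value v0; case: (mover h == p); rewrite ?subrr.
have Ks : K (s (mover h) h) by apply: sK => //; split=> //; rewrite E.
apply: (@le_trans _ _ (\sum_(i < m) s (mover h) h 0 i *
    play_value v p (k - i)%N ((s (mover h) h, i) :: h))).
  apply: ler_sum => i _; apply: ler_wpM2l; first by have [] := KS _ Ks.
  rewrite IH ?ltnS ?leq_subr//; last exact: moves_in_cons.
  by rewrite pile_cons E.
rewrite /play_value; under eq_bigr do rewrite mover_cons.
have [Ko vk vge] := vS k.
have [<-|hp] := eqVneq (mover h) p.
  by under eq_bigr do rewrite negb_eq; exact: vge.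
have {}hp : mover h = ~~ p by case: (mover h) hp; case: (p).
rewrite hp sopt E negbK eqxx vk expect_compl; last exact: KS.
by rewrite subKr.
Qed.

(** The upper bound applies to both players, and their probabilities add up to
    1. *)
Lemma optimal_play_value (R : realType) (m n : nat) (K : set 'rV[R]_m)
    v opt s p h :
  K `<=` simplex R m -> bellman K v opt -> stays_in n K s ->
  (forall q h, s q h = opt (pile n h)) -> moves_in K h ->
  win_prob s p (pile n h) h = play_value v p (pile n h) h.
Proof.
move=> KS vB sK sopt Kh; apply/eqP; rewrite eq_le.
rewrite (optimal_reply_bound KS vB sK (sopt _) Kh)/=.
have := optimal_reply_bound KS vB sK (sopt (~~ ~~ p)) Kh.
by rewrite (win_prob_opponent _ KS sK Kh) play_value_opponent lerD2l lerN2.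
Qed.

Lemma deviation_stays_in (R : realType) (m n : nat) (K : set 'rV[R]_m) s p t :
  stays_in n K s -> is_strategy n K p t -> stays_in n K [eta s with p |-> t].
Proof.
by move=> sK tK q /=; case: (eqVneq q p) => [->|_].
Qed.

(** * Subgame perfect equilibria *)

Lemma optimal_subgame_perfect (R : realType) (m n : nat) (K : set 'rV[R]_m)
    v opt :
  K `<=` simplex R m -> bellman K v opt ->
  subgame_perfect n K (fun _ h => opt (pile n h)).
Proof.
move=> KS vB; set s := (fun _ _ => _).
have sK : stays_in n K s.
  move=> p h [Kh]; rewrite /s; case: (pile n h) => // k _ _.
  by have [] := vB.2 k.
split=> // x xK p t tK.
have better h : moves_in K h ->
    win_prob [eta s with p |-> t] p (pile n h) h <= win_prob s p (pile n h) h.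
  move=> Kh; rewrite [leRHS](optimal_play_value _ KS vB)//.
  apply: (optimal_reply_bound KS vB (deviation_stays_in sK tK) _ Kh) => h' /=.
  by rewrite negb_eq.
case: x xK => [h [Kh _]|h pi [[Kh _] Kpi]] /=; first exact: better.
apply: ler_sum => i _; apply: ler_wpM2l; first by have [] := KS _ Kpi.
by apply: better; exact: moves_in_cons.
Qed.

(** The play from [h] on never consults a strategy at a history shorter than
    [h]. This makes a deviation at histories of the length of [h] invisible once
    the move at [h] is made. *)
Lemma win_prob_eq (R : realType) (m : nat) (s s' : profile R m) p k h :
  (forall q h', (size h <= size h')%N -> s q h' = s' q h') ->
  win_prob s p k h = win_prob s' p k h.
Proof.
elim/ltn_ind: k h => -[//|k IH] h ss' /=.
rewrite ss'//; apply: eq_bigr => i _; rewrite IH ?ltnS ?leq_subr//.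
by move=> q h' /ltnW; exact: ss'.
Qed.

(** The equilibrium condition enters only through one-shot deviations: a
    switch at [h] to an optimal lottery is not profitable, and the values after
    the next move are known by induction. *)
Lemma subgame_perfect_value (R : realType) (m n : nat) (K : set 'rV[R]_m)
    v opt s p h :
  K `<=` simplex R m -> bellman K v opt -> subgame_perfect n K s ->
  moves_in K h -> win_prob s p (pile n h) h = play_value v p (pile n h) h.
Proof.
move=> KS vB [sK sN]; have [v0 vS] := vB.
move E : (pile n h) => k; elim/ltn_ind: k p h E => -[_|k IH] p h E Kh.
  by rewrite /= /play_value v0; case: (mover h == p); rewrite ?subrr.
(* The other player gets the complement, so only the mover matters. *)
wlog -> : p / p = mover h => [mover_value|].
  have [->|hp] := eqVneq p (mover h); first exact: mover_value.
  have {hp}-> : p = ~~ mover h by case: (mover h) hp; case: (p).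
  rewrite -E (win_prob_opponent _ KS)// play_value_opponent E.
  by rewrite mover_value.
rewrite /play_value eqxx.
have hK : decision_history n K h by split; rewrite ?E.
have [Ko vk vge] := vS k.
have next pi (i : 'I_m) : K pi -> win_prob s (mover h) (k - i)%N ((pi, i) :: h) =
    1 - v (k - i)%N.
  move=> Kpi; rewrite IH ?ltnS ?leq_subr//; last exact: moves_in_cons.
    by rewrite /play_value mover_cons negb_eq.
  by rewrite pile_cons E.
apply/eqP; rewrite eq_le; apply/andP; split.
  have Ks : K (s (mover h) h) by exact: sK.
  rewrite /=; under eq_bigr do rewrite (next _ _ Ks).
  exact: vge.
(* Changing s at all histories as long as h is as good as changing it at h,
   since no other one of them is reached from h. *)
pose t h' := if size h' == size h then opt k.+1 else s (mover h) h'.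
have tK : is_strategy n K (mover h) t.
  by move=> h' h'K h'h; rewrite /t; case: ifP => // _; exact: sK.
have := sN (Decision h) hK (mover h) t tK; rewrite /= E; apply: le_trans.
have th : t h = opt k.+1 by rewrite /t eqxx.
rewrite vk /= eqxx th; apply: ler_sum => i _; apply: ler_wpM2l.
  by have [] := KS _ Ko.
rewrite -(next (opt k.+1))// (@win_prob_eq _ _ _ s)// => q h' hh' /=.
by case: (eqVneq q) => [->|//]; rewrite /t gtn_eqF.
Qed.

(** * Convergence of the values *)

Lemma coord_le_eta (R : realType) (m : nat) (K : set 'rV[R]_m) pi i :
  K `<=` simplex R m -> K pi -> pi 0 i <= eta_of K.
Proof.
move=> KS Kpi.
have max_le1 rho : K rho -> \big[Num.max/0]_(i < m) rho 0 i <= 1.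
  move=> /KS [rho0 rho1]; apply: bigmax_le => // j _.
  by rewrite -rho1 (bigD1 j)//= lerDl sumr_ge0.
apply: (le_trans (le_bigmax 0 (fun i => pi 0 i) i)).
by apply: ub_le_sup; [exists 1 => _ [rho Krho <-]; exact: max_le1|exists pi].
Qed.

(** The maximal probability of taking [i.+1] objects is attained, since a
    coordinate is a linear function. *)
Lemma nu_le_coord (R : realType) (m : nat) (K : set 'rV[R]_m) i :
  K !=set0 -> compact K -> exists2 pi, K pi & nu_of K <= pi 0 i.
Proof.
move=> K0 Kc.
have [pi Kpi piP] := linear_attains_max (fun j => (j == i)%:R) K0 Kc.
have coord (rho : 'rV[R]_m) : \sum_(j < m) rho 0 j * (j == i)%:R = rho 0 i.
  rewrite (bigD1 i)//= eqxx mulr1 big1 ?addr0// => j /negbTE ->.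
  by rewrite mulr0.
exists pi => //.
apply: (@le_trans _ _ (sup [set rho 0 i | rho in K])); first exact: bigmin_le.
apply: ge_sup => [|_ [rho Krho <-]]; first by case: K0 => rho; exists (rho 0 i), rho.
by rewrite -!coord; exact: piP.
Qed.

(** The excess over one half turns the Bellman equation, where a move replaces
    a probability by its complement, into one where it changes signs. *)
Definition advantage (R : realType) (v : nat -> R) k : R := v k - 1 / 2.

Lemma bellman_advantage (R : realType) (m : nat) (K : set 'rV[R]_m) v opt k :
  K `<=` simplex R m -> bellman K v opt ->
  (forall pi, K pi ->
     - \sum_(i < m) pi 0 i * advantage v (k - i)%N <= advantage v k.+1) /\
  advantage v k.+1 = - \sum_(i < m) opt k.+1 0 i * advantage v (k - i)%N.
Proof.
move=> KS [_ /(_ k)[Ko vk vge]].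
have adv pi : K pi -> - \sum_(i < m) pi 0 i * advantage v (k - i)%N =
    \sum_(i < m) pi 0 i * (1 - v (k - i)%N) - 1 / 2.
  move=> /KS piS; rewrite expect_compl//; case: piS => _ pi1.
  under eq_bigr do rewrite mulrBr.
  by rewrite sumrB -mulr_suml pi1; lra.
by split=> [pi Kpi|]; rewrite adv// /advantage ?lerD2r ?vge// vk.
Qed.

(** If one of the positions reachable in one move has advantage at most
    [eta * M], then a lottery reaching it with probability at least [nu] loses at
    most [(1 - nu * (1 - eta)) * M]. Such a position exists: if all the reachable
    ones exceeded [eta * M], the nearest one, [k], could only be good by moving
    to [k - m], the single position among its successors not known to be
    good for the opponent; and this happens with probability at most [eta]. *)
Lemma advantage_lower (R : realType) (m : nat) (K : set 'rV[R]_m) v opt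
    (M nu eta : R) N k :
  K `<=` simplex R m -> bellman K v opt -> (0 < m)%N ->
  (forall pi i, K pi -> pi 0 i <= eta) ->
  (forall i, exists2 pi, K pi & nu <= pi 0 i) ->
  0 <= M -> 0 <= eta -> eta <= 1 ->
  (forall j, (N <= j)%N -> `|advantage v j| <= M) ->
  (N + m <= k)%N ->
  - ((1 - nu * (1 - eta)) * M) <= advantage v k.+1.
Proof.
move=> KS vB m0 etaP nuP M0 eta0 eta1 qM Nk.
have qk (i : 'I_m) : `|advantage v (k - i)%N| <= M by apply: qM; have := ltn_ord i; lia.
have [j qj] : exists j : 'I_m, advantage v (k - j)%N <= eta * M.
  have [/existsP//|/existsPn big] :=
    boolP [exists j : 'I_m, advantage v (k - j)%N <= eta * M].
  have {}big j : (j < m)%N -> eta * M < advantage v (k - j)%N.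
    by move=> jm; have := big (Ordinal jm); rewrite -ltNge.
  have := big 0%N m0; rewrite subn0 ltNge => /negP[].
  case: k Nk qk big => [|k] Nk qk big; first by lia.
  have [_ ->] := bellman_advantage k KS vB; have [Ko _ _] := vB.2 k.
  have lm : (m.-1 < m)%N by lia.
  (* l stands for taking m objects from k.+1, the only move that may help. *)
  pose l := Ordinal lm.
  have ql : `|advantage v (k - l)%N| <= M by apply: qM => /=; lia.
  rewrite (bigD1 l)//= opprD.
  apply: (@le_trans _ _ (opt k.+1 0 l * M)); last exact/ler_wpM2r/etaP.
  rewrite -[leRHS]addr0; apply: lerD.
    rewrite -mulrN; apply: ler_wpM2l; first by have [] := KS _ Ko.
    by apply: le_trans ql; rewrite -normrN ler_norm.
  rewrite oppr_le0; apply: sumr_ge0 => i /eqP il.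
  apply: mulr_ge0; first by have [] := KS _ Ko.
  have im : (i.+1 < m)%N.
    have im : i <> m.-1 :> nat by move=> im; apply: il; exact: val_inj.
    by have := ltn_ord i; lia.
  apply: ltW; apply: le_lt_trans (big _ im); exact: mulr_ge0.
have [pi Kpi nupi] := nuP j; have [pi0 pi1] := KS _ Kpi.
have [adv _] := bellman_advantage k KS vB.
apply: le_trans (adv _ Kpi); rewrite lerN2.
(* What the lottery loses short of M, of which j alone accounts for enough. *)
suff : nu * ((1 - eta) * M) <= \sum_(i < m) pi 0 i * (M - advantage v (k - i)%N).
  under eq_bigr do rewrite mulrBr.
  by rewrite sumrB -mulr_suml pi1; lra.
rewrite (bigD1 j)//=; apply: (@le_trans _ _ (pi 0 j * (M - advantage v (k - j)%N))).
  have X0 : 0 <= (1 - eta) * M by rewrite mulr_ge0// subr_ge0.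
  apply: (le_trans (ler_wpM2r X0 nupi)); apply: ler_wpM2l => //; lra.
rewrite lerDl; apply: sumr_ge0 => i _; rewrite mulr_ge0// subr_ge0.
by apply: le_trans (qk i); exact: ler_norm.
Qed.

(** A position cannot be good unless it leads to bad ones, so that
    the lower bound for the [m] positions before [k] is an upper bound for [k].
    The delay consists of [m.+1] steps for that lower bound and [m] more for
    the move that leads there. *)
Lemma advantage_contract (R : realType) (m : nat) (K : set 'rV[R]_m) v opt
    (M nu eta : R) N k :
  K `<=` simplex R m -> bellman K v opt -> (0 < m)%N ->
  (forall pi i, K pi -> pi 0 i <= eta) ->
  (forall i, exists2 pi, K pi & nu <= pi 0 i) ->
  0 <= M -> 0 <= eta -> eta <= 1 ->
  (forall j, (N <= j)%N -> `|advantage v j| <= M) ->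
  (N + (m + m).+1 <= k)%N ->
  `|advantage v k| <= (1 - nu * (1 - eta)) * M.
Proof.
move=> KS vB m0 etaP nuP M0 eta0 eta1 qM.
have low := advantage_lower KS vB m0 etaP nuP M0 eta0 eta1 qM.
case: k => [|k] Nk; first by lia.
rewrite ler_norml low ?andTb; last by lia.
have [_ ->] := bellman_advantage k KS vB; have [/KS[pi0 pi1] _ _] := vB.2 k.
rewrite lerNl -[leLHS]mul1r -[X in X * _ <= _]pi1 mulr_suml; apply: ler_sum => i _.
apply: ler_wpM2l => //; have im := ltn_ord i.
have -> : (k - i)%N = (k - i).-1.+1 by lia.
apply: low; lia.
Qed.

Lemma advantage_cvg0 (R : realType) (m : nat) (K : set 'rV[R]_m) v opt
    (nu eta : R) :
  K `<=` simplex R m -> bellman K v opt -> (0 < m)%N ->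
  (forall pi i, K pi -> pi 0 i <= eta) ->
  (forall i, exists2 pi, K pi & nu <= pi 0 i) ->
  0 < nu -> eta < 1 -> advantage v k @[k --> \oo] --> (0 : R).
Proof.
move=> KS vB m0 etaP nuP nu0 eta1; pose c := 1 - nu * (1 - eta).
have [pi /[dup] Kpi /KS[pi0 _] nupi] := nuP (Ordinal m0).
have eta0 : 0 <= eta by apply: le_trans (etaP _ (Ordinal m0) Kpi).
have nu1 : nu <= 1 by apply: (le_trans nupi); apply: le_trans (ltW eta1); exact: etaP.
have c0 : 0 <= c by rewrite /c; nra.
have c1 : c < 1 by rewrite /c; nra.
(* The initial bound 1 is crude: probabilities differ from 1/2 by at most 1/2. *)
have decay r k : (r * (m + m).+1 <= k)%N -> `|advantage v k| <= c ^+ r.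
  elim: r k => [|r IH] k rk.
    have /andP[v0 v1] := bellman_bounds KS vB k.
    by rewrite expr0 /advantage ler_norml; apply/andP; split; lra.
  rewrite exprS; apply: (advantage_contract KS vB m0 etaP nuP _ eta0 _ IH).
  - exact: exprn_ge0.
  - exact: ltW.
  - by rewrite mulSn addnC in rk.
apply/cvgrPdist_le => e e0.
have /cvgrPdist_le/(_ e e0)[r _ re] : c ^+ r @[r --> \oo] --> (0 : R).
  by apply: cvg_expr; rewrite ger0_norm.
exists (r * (m + m).+1)%N => // k /= rk.
rewrite sub0r normrN; apply: (le_trans (decay _ _ rk)).
by have := re r (leqnn r); rewrite /= sub0r normrN ger0_norm// exprn_ge0.
Qed.

Theorem theorem1 (R : realType) (m : nat) (K : set 'rV[R]_m)
    (m_gt1 : (1 < m)%N) (K_simplex : K `<=` simplex R m) (K_neq0 : K !=set0)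
    (K_compact : compact K) (eta_lt1 : eta_of K < 1) (nu_gt0 : 0 < nu_of K) :
  exists p : nat -> R,
    [/\ forall n : nat, (1 <= n)%N ->
          exists s : profile R m, subgame_perfect n K s,
        forall n : nat, (1 <= n)%N ->
          forall s : profile R m, subgame_perfect n K s ->
          first_win_prob n s = p n
      & p n @[n --> \oo] --> (1 / 2 : R)].
Proof.
have [opt vB] := bellman_value K_neq0 K_compact.
exists (value K); split.
- move=> n _; exists (fun _ h => opt (pile n h)).
  exact: optimal_subgame_perfect K_simplex vB.
- move=> n _ s sP.
  rewrite /first_win_prob /= (subgame_perfect_value _ K_simplex vB sP)//.
  by rewrite /play_value /pile /taken big_nil subn0.
apply/subr_cvg0.
exact: (advantage_cvg0 K_simplex vB (ltnW m_gt1)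
  (fun pi i => coord_le_eta i K_simplex) (fun i => nu_le_coord i K_neq0 K_compact)).
Qed.
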